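(* Let $(X,\mathbb{A},d)$ be a $C^{\ast}$-algebra valued metric space and let $C_{x_0,r}^{C^{\ast}}$ be any circle on $X$ (with $x_0\in X$, $r\in\mathbb{A}_+$). Define $\varphi:X\to\mathbb{A}_+$ by $\varphi(x)=d(x,x_0)$ for all $x\in X$. If $T:X\to X$ is a self-mapping for which there is some $A\in\mathbb{A}$ with $\|A\|<1$ such that $$d(x,Tx)\preceq \varphi(x)-\varphi(Tx)\qquad\text{and}\qquad r\preceq A^{\ast}d(x,Tx)A+d(Tx,x_0)$$ for all $x\in C_{x_0,r}^{C^{\ast}}$, then the circle $C_{x_0,r}^{C^{\ast}}$ is a fixed circle of $T$.
   Context: $\mathbb{A}$ is a unital $C^{\ast}$-algebra with unit $I$ and zero element $\theta$. $\mathbb{A}_h=\{a\in\mathbb{A}: a=a^{\ast}\}$. An element $a\in\mathbb{A}$ is positive, written $\theta\preceq a$, if $a\in\mathbb{A}_h$ and its spectrum is contained in $[0,\infty)$; $\mathbb{A}_+$ is the set of positive elements (so $\theta\in\mathbb{A}_+$). For $a,b\in\mathbb{A}_h$, $a\preceq b$ means $b-a\in\mathbb{A}_+$. A $C^{\ast}$-algebra valued metric space $(X,\mathbb{A},d)$ is a nonempty set $X$ with a map $d:X\times X\to\mathbb{A}$ such that for all $x,y,z\in X$: (i) $\theta\preceq d(x,y)$, and $d(x,y)=\theta$ if and only if $x=y$; (ii) $d(x,y)=d(y,x)$; (iii) $d(x,y)\preceq d(x,z)+d(z,y)$. For $x_0\in X$ and $r\in\mathbb{A}_+$, the circle with center $x_0$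 and radius $r$ is $C_{x_0,r}^{C^{\ast}}=\{x\in X: d(x,x_0)=r\}$. For a self-mapping $T:X\to X$, the circle $C_{x_0,r}^{C^{\ast}}$ is called a fixed circle of $T$ if $Tx=x$ for all $x\in C_{x_0,r}^{C^{\ast}}$. *)

(* Defs.v *)
From HB Require Import structures.
From mathcomp Require Import all_boot all_order all_algebra.
From mathcomp Require Import complex.
From mathcomp Require Import boolp classical_sets reals topology normedtype.

Set Implicit Arguments.
Unset Strict Implicit.
Unset Printing Implicit Defensive.

Import Order.TTheory GRing.Theory Num.Theory.
Import numFieldNormedType.Exports.

Local Open Scope classical_set_scope.
Local Open Scope ring_scope.
Local Open Scope complex_scope.

(* MathComp has no join of its ring and normed-module hierarchies below        *)
(* numDomainType, so the ring operations are laid over a Banach space here and *)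
(* the pzRingType instance is derived from them just below.                    *)
(* Norms are R[i]-valued, as for every normed module over R[i], and they are   *)
(* >= 0 for the partial order of R[i], in which x <= y makes y - x real.       *)
(* The unit is not required to differ from 0.                                  *)
HB.mixin Record isCStarAlgebra (R : realType) A
    of CompleteNormedModule R[i] A := {
  cone : A;
  cmul : A -> A -> A;
  cmulA : associative cmul;
  cmul1a : left_id cone cmul;
  cmula1 : right_id cone cmul;
  cmulDl : left_distributive cmul +%R;
  cmulDr : right_distributive cmul +%R;
  cscaleAl : forall (z : R[i]) (a b : A), z *: cmul a b = cmul (z *: a) b;
  cscaleAr : forall (z : R[i]) (a b : A), z *: cmul a b = cmul a (z *: b);
  cnormM : forall a b : A, `|cmul a b| <= `|a| * `|b|;
  adj : A -> A;
  adjK : involutive adj;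
  adjD : {morph adj : a b / a + b};
  adjZ : forall (z : R[i]) (a : A), adj (z *: a) = Num.conj z *: adj a;
  adjM : forall a b : A, adj (cmul a b) = cmul (adj b) (adj a);
  cnorm_adjM : forall a : A, `|cmul (adj a) a| = `|a| ^+ 2
}.

#[short(type="cstarAlgType")]
HB.structure Definition CStarAlgebra (R : realType) :=
  {A of CompleteNormedModule R[i] A & isCStarAlgebra R A}.

HB.instance Definition _ (R : realType) (A : cstarAlgType R) :=
  GRing.Zmodule_isPzRing.Build (CStarAlgebra.sort A)
    (@cmulA R A) (@cmul1a R A) (@cmula1 R A) (@cmulDl R A) (@cmulDr R A).

Section Positivity.
Context {R : realType} {A : cstarAlgType R}.
Implicit Types a b : A.

Definition selfadjoint a : Prop := adj a = a.

(* A is not equipped with a decidable inverse, so GRing.unit is unavailable. *)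
Definition invertible a : Prop := exists b, a * b = 1 /\ b * a = 1.

Definition spectrum a : set R[i] := [set z | ~ invertible (z *: (1 : A) - a)].

(* In R[i], 0 <= z means that z is real and nonnegative. *)
Definition cpositive a : Prop :=
  selfadjoint a /\ spectrum a `<=` [set z | 0 <= z].

Definition cle a b : Prop :=
  [/\ selfadjoint a, selfadjoint b & cpositive (b - a)].

End Positivity.

Record is_cstar_metric (R : realType) (A : cstarAlgType R) (X : Type)
    (d : X -> X -> A) : Prop := IsCStarMetric {
  cmetric_inhabited : inhabited X;
  cmetric_ge0 : forall x y, cpositive (d x y);
  cmetric_eq0 : forall x y, d x y = 0 <-> x = y;
  cmetric_sym : forall x y, d x y = d y x;
  cmetric_triangle : forall x y z, cle (d x y) (d x z + d z y)
}.

Definition circle (R : realType) (A : cstarAlgType R) (X : Type)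
    (d : X -> X -> A) (x0 : X) (r : A) : set X := [set x | d x x0 = r].

Definition fixed_circle (X : Type) (T : X -> X) (C : set X) : Prop :=
  forall x, C x -> T x = x.

(* Main.v *)
Require Import Defs.
From mathcomp Require Import all_boot all_order all_algebra.
From mathcomp Require Import lra.
From mathcomp Require Import complex.
From mathcomp Require Import boolp classical_sets reals topology normedtype.
From mathcomp Require Import sequences realfun.

(** Fix [x] on the circle and put [p = d x (T x)], [u = d (T x) x0].  The two
    hypotheses say that [q1 = r - u - p] and [q2 = adj a * p * a + u - r] are
    positive, and [p + q1 + q2 = adj a * p * a].  The norm is monotone on
    positive elements, so |p| <= |adj a * p * a| <= |a|^2 |p|, and |a| < 1
    forces [p = 0], that is [T x = x].

    The substance is the monotonicity of the norm
    ([nrm_le_positive_add2]), positivity being defined by the spectrum.  If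
    [q] is positive and |q| <= t, then |t - q| <= t; if [p] is positive and
    nonzero, then |p| + t <= |t + p|.  Adding [t1 - q1], [t2 - q2] and
    [p + q1 + q2] by the triangle inequality gives
    |p| + t1 + t2 <= t1 + t2 + |p + q1 + q2|.

    Both inequalities follow from two facts on the spectrum: it lies in the
    disc of radius |a| ([spectrum_le_nrm], by the Neumann series), and for a
    nonzero selfadjoint [h] it meets the circle of radius |h|
    ([selfadjoint_spectral_radius]).

    For the second fact, normalise |h| = 1 and suppose that [1 - z *: h] is
    invertible for every [z] of modulus 1.  By compactness of the circle the
    inverses are uniformly bounded, so for some [s < 1] the inverses of [1 - z *: h] and
    [1 - (z * s) *: h] differ by at most 1/8, uniformly in [z].  The identity
    (1 - z^2 g^2)^-1 = ((1 - z g)^-1 + (1 + z g)^-1) / 2 carries this estimate,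
    with the same 1/8, from [(h, s)] to [(h ^+ 2, s ^+ 2)], hence to
    [(h ^+ 2 ^ n, s ^+ 2 ^ n)].  For large [n] the second inverse is close to
    1, hence so is the inverse of [1 - h ^+ 2 ^ n], and [h ^+ 2 ^ n] has norm
    below 1.  But the C*-identity gives it norm 1. *)

Set Implicit Arguments.
Unset Strict Implicit.
Unset Printing Implicit Defensive.

Import Order.TTheory GRing.Theory Num.Theory.
Import numFieldNormedType.Exports.
Import Normc.

Local Open Scope classical_set_scope.
Local Open Scope ring_scope.
Local Open Scope complex_scope.

(** * Modulus and norm with real values *)

Section ComplexModulus.
Context {R : realType}.
Implicit Types (x : R) (z : R[i]).

Lemma normcE_norm z : `|z| = (normc z)%:C.
Proof. by case: z. Qed.

Lemma normc_real x : normc x%:C = `|x|.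
Proof. by rewrite /= expr0n addr0 sqrtr_sqr. Qed.

Lemma normc_ge0 z : 0 <= normc z.
Proof. by case: z => x y; rewrite sqrtr_ge0. Qed.

Lemma ge0_complexP z : 0 <= z -> exists2 x, 0 <= x & z = x%:C.
Proof. by case: z => x y; rewrite lecE /= => /andP[/eqP -> x0]; exists x. Qed.

Lemma gt0_complexP z : 0 < z -> exists2 x, 0 < x & z = x%:C.
Proof. by case: z => x y; rewrite ltcE /= => /andP[/eqP -> x0]; exists x. Qed.

End ComplexModulus.

Section Norm.
Context {R : realType} {A : cstarAlgType R}.
Implicit Types (a b : A) (z : R[i]).

(** The norm of the algebra takes its values in [R[i]], whose order is only
    partial; its real part carries the same information in a total order. *)
Definition nrm a : R := complex.Re `|a|.

Lemma nrmE a : `|a| = (nrm a)%:C.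
Proof. by have [x _ e] := ge0_complexP (normr_ge0 a); rewrite /nrm e. Qed.

Lemma nrm_ge0 a : 0 <= nrm a.
Proof. by rewrite -ler0c -nrmE. Qed.

Lemma nrm_eq0 a : nrm a = 0 -> a = 0.
Proof. by move=> a0; apply/eqP; rewrite -normr_eq0 nrmE a0. Qed.

Lemma nrm0 : nrm 0 = 0.
Proof. by rewrite /nrm normr0. Qed.

Lemma nrmN a : nrm (- a) = nrm a.
Proof. by rewrite /nrm normrN. Qed.

Lemma nrmD a b : nrm (a + b) <= nrm a + nrm b.
Proof. by rewrite -lecR rmorphD /= -!nrmE ler_normD. Qed.

Lemma nrmB a b : nrm (a - b) <= nrm a + nrm b.
Proof. by rewrite -(nrmN b) nrmD. Qed.

Lemma nrmM a b : nrm (a * b) <= nrm a * nrm b.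
Proof. by rewrite -lecR rmorphM /= -!nrmE; exact: cnormM. Qed.

Lemma nrmZ z a : nrm (z *: a) = normc z * nrm a.
Proof. by apply: complexI; rewrite rmorphM /= -!nrmE normrZ normcE_norm. Qed.

Lemma scaleAl z a b : z *: (a * b) = (z *: a) * b.
Proof. exact: cscaleAl. Qed.

Lemma scaleAr z a b : z *: (a * b) = a * (z *: b).
Proof. exact: cscaleAr. Qed.

Lemma nrm_adjM a : nrm (adj a * a) = nrm a ^+ 2.
Proof. by apply: complexI; rewrite rmorphXn /= -!nrmE; exact: cnorm_adjM. Qed.

Lemma cadjM a b : adj (a * b) = adj b * adj a.
Proof. exact: adjM. Qed.

Lemma cadjB a b : adj (a - b) = adj a - adj b.
Proof. by rewrite -[- b]scaleN1r adjD Defs.adjZ rmorphN1 scaleN1r. Qed.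

Lemma cadj_real_scale (x : R) a : adj (x%:C *: a) = x%:C *: adj a.
Proof. by rewrite Defs.adjZ conj_Creal// complex_real. Qed.

Lemma cadj1 : adj (1 : A) = 1.
Proof.
by have := cadjM 1 (adj 1); rewrite mul1r adjK mul1r.
Qed.

Lemma nrm1_le1 : nrm (1 : A) <= 1.
Proof.
have := nrm_adjM 1; rewrite cadj1 mul1r => e.
rewrite leNgt; apply/negP => n1.
by have := nrm_ge0 1; nra.
Qed.

(** Cancel |a| in |a|^2 = |adj a * a| <= |adj a| |a|. *)
Lemma nrm_adj_le a : nrm a <= nrm (adj a).
Proof.
have := nrm_adjM a; have := nrmM (adj a) a.
have := nrm_ge0 a; have := nrm_ge0 (adj a).
rewrite [nrm a ^+ 2]expr2; nra.
Qed.

Lemma nrm_adj a : nrm (adj a) = nrm a.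
Proof.
by apply/eqP; rewrite eq_le nrm_adj_le andbT -{2}[a]adjK nrm_adj_le.
Qed.

Lemma nrm_selfadjoint_sqr a : selfadjoint a -> nrm (a * a) = nrm a ^+ 2.
Proof. by move=> aa; rewrite -nrm_adjM aa. Qed.

Lemma nrmX_le a n : nrm (a ^+ n) <= nrm a ^+ n.
Proof.
elim: n => [|n IH]; first by rewrite !expr0 nrm1_le1.
by rewrite !exprS (le_trans (nrmM _ _))// ler_wpM2l// nrm_ge0.
Qed.

End Norm.

(** * Inverses and the Neumann series *)

Section Invertibility.
Context {R : realType} {A : cstarAlgType R}.
Implicit Types (a b : A) (z : R[i]).

Definition is_inverse a b := a * b = 1 /\ b * a = 1.

Lemma invertibleN a : invertible (- a) -> invertible a.
Proof. by case=> b [ab ba]; exists (- b); rewrite mulrN mulNr -mulNr -mulrN. Qed.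

Lemma invertibleZ z a : z != 0 -> invertible a -> invertible (z *: a).
Proof.
move=> z0 [b [ab ba]]; exists (z^-1 *: b); split.
  by rewrite -scaleAr -scaleAl ab !scalerA mulVf// scale1r.
by rewrite -scaleAr -scaleAl ba !scalerA mulfV// scale1r.
Qed.

Lemma is_inverseM a b a' b' :
  is_inverse a b -> is_inverse a' b' -> is_inverse (a * a') (b' * b).
Proof.
move=> [ab ba] [ab' ba']; split.
  by rewrite mulrA -[a * a' * _]mulrA ab' mulr1.
by rewrite mulrA -[b' * b * _]mulrA ba mulr1.
Qed.

(** The resolvent identity. *)
Lemma sub_inverse u v b c : is_inverse u b -> is_inverse v c ->
  b - c = b * (v - u) * c.
Proof.
by move=> [_ bu] [vc _]; rewrite mulrBr mulrBl bu mul1r -mulrA vc mulr1.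
Qed.

(** By the resolvent identity [c = b - b * (v - u) * c], and the last term has
    norm at most half of that of [c]. *)
Lemma nrm_inverse_le u v b c : is_inverse u b -> is_inverse v c ->
  nrm b * nrm (v - u) <= 2^-1 -> nrm c <= 2 * nrm b.
Proof.
move=> ub vc small.
have e : c = b - b * (v - u) * c by rewrite -(sub_inverse ub vc) opprB addrC subrK.
have : nrm c <= nrm b + nrm b * nrm (v - u) * nrm c.
  rewrite {1}e (le_trans (nrmB _ _))// lerD2l (le_trans (nrmM _ _))//.
  by rewrite ler_wpM2r ?nrm_ge0 ?nrmM.
have := ler_wpM2r (nrm_ge0 c) small; lra.
Qed.

Lemma nrm_inverseB_le u v b c : is_inverse u b -> is_inverse v c ->
  nrm b * nrm (v - u) <= 2^-1 ->
  nrm (b - c) <= 2 * nrm b ^+ 2 * nrm (v - u).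
Proof.
move=> ub vc small; rewrite (sub_inverse ub vc).
have c_le := nrm_inverse_le ub vc small.
rewrite (le_trans (nrmM _ _))//.
apply: le_trans (_ : nrm b * nrm (v - u) * (2 * nrm b) <= _).
  by apply: ler_pM; rewrite ?nrm_ge0 ?nrmM.
by rewrite expr2; lra.
Qed.

(** The geometric series of [a] converges by completeness, and its sum inverts
    [1 - a] because the partial sums telescope. *)
Lemma neumann a : nrm a < 1 -> invertible (1 - a).
Proof.
move=> a1.
pose S := series (fun k => a ^+ k).
have geom_cauchy : cauchy (series (geometric 1 (nrm a)) @ \oo).
  apply/cauchy_cvgP; apply: is_cvg_geometric_series.
  by rewrite ger0_norm ?nrm_ge0.
have S_cvg : cvg (S @ \oo).
  apply/cauchy_cvgP/cauchy_seriesP => _ /gt0_complexP[e e0 ->].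
  move/cauchy_seriesP : geom_cauchy => /(_ e e0).
  apply: filterS => -[m n] /= lt_e; rewrite nrmE ltcR.
  apply: le_lt_trans lt_e; rewrite (le_trans _ (ler_norm _))//.
  elim/big_ind2 : _ => [|x1 x2 y1 y2 h1 h2|k _]; first by rewrite nrm0.
    by rewrite (le_trans (nrmD _ _))// lerD.
  by rewrite mul1r nrmX_le.
pose s := lim (S @ \oo).
have tele n : S n * (1 - a) = 1 - a ^+ n.
  rewrite /S /series /= mulr_suml; elim: n => [|n IH].
    by rewrite big_geq// expr0 subrr.
  by rewrite big_nat_recr//= IH mulrBr mulr1 -exprSr addrA subrK.
have telel n : (1 - a) * S n = 1 - a ^+ n.
  rewrite -tele /S /series /= mulr_suml mulr_sumr; apply: eq_bigr => k _.
  by rewrite mulrBl mulrBr mul1r mulr1 -exprS -exprSr.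
have approx e : 0 < e -> exists n, nrm (s - S n) < e /\ nrm a ^+ n < e.
  move=> e0.
  have /cvgrPdist_lt/(_ e%:C) : S @ \oo --> s by [].
  rewrite ltcR => /(_ e0) h1.
  have /cvgrPdist_lt/(_ e e0) h2 : (nrm a) ^+ n @[n --> \oo] --> 0.
    by apply: cvg_expr; rewrite ger0_norm ?nrm_ge0.
  have [n /= [n1 n2]] := filter_ex (filterI h1 h2).
  exists n; split; first by rewrite -ltcR -nrmE.
  by apply: le_lt_trans n2; rewrite sub0r normrN ler_norm.
have lim_one b :
    (forall n, nrm (b - 1) <= nrm (s - S n) * nrm (1 - a) + nrm a ^+ n) ->
    b = 1.
  move=> b_le; apply/eqP; rewrite -subr_eq0; apply/eqP/nrm_eq0/eqP.
  rewrite eq_le nrm_ge0 andbT; apply/ler_addgt0Pr => e e0; rewrite add0r.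
  (* With [e / 3] the bound is at most [e], because |1 - a| <= 2. *)
  have [n [n1 n2]] := approx (e / 3) ltac:(by rewrite divr_gt0).
  have := b_le n; have := nrmB 1 a; have := nrm1_le1 (A := A).
  have := nrm_ge0 (s - S n); have := nrm_ge0 (1 - a); nra.
exists s; split; apply: lim_one => n.
- have -> : (1 - a) * s - 1 = (1 - a) * (s - S n) - a ^+ n.
    by rewrite mulrBr telel -[in RHS]addrA -opprD subrK.
  rewrite (le_trans (nrmB _ _))// lerD ?nrmX_le//.
  by rewrite mulrC nrmM.
- have -> : s * (1 - a) - 1 = (s - S n) * (1 - a) - a ^+ n.
    by rewrite mulrBl tele -[in RHS]addrA -opprD subrK.
  by rewrite (le_trans (nrmB _ _))// lerD ?nrmX_le// nrmM.
Qed.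

Lemma spectrum_le_nrm a z : spectrum a z -> normc z <= nrm a.
Proof.
move=> za; rewrite leNgt; apply/negP => az; apply: za.
have z0 : z != 0.
  by apply: contraTneq az => ->; rewrite normc0 -leNgt nrm_ge0.
have nz : 0 < normc z := le_lt_trans (nrm_ge0 a) az.
have -> : z *: (1 : A) - a = z *: (1 - z^-1 *: a).
  by rewrite scalerBr scalerA mulfV// scale1r.
apply: invertibleZ => //; apply: neumann.
by rewrite nrmZ normcV mulrC ltr_pdivrMr// mul1r.
Qed.

End Invertibility.

(** * Compactness of the unit circle *)

Section UnitCircle.
Context {R : realType}.

Definition upper_arc (x : R) : R[i] := x +i* Num.sqrt (1 - x ^+ 2).

Lemma upper_arc_continuous (x e : R) : 0 < e ->
  \forall y \near x, normc (upper_arc y - upper_arc x) < e.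
Proof.
move=> e0.
have e20 : 0 < e / 2 by rewrite divr_gt0.
have sc : (fun y : R => Num.sqrt (1 - y ^+ 2)) @ x --> Num.sqrt (1 - x ^+ 2).
  apply: (continuous_comp (f := fun y : R => 1 - y ^+ 2)); last exact: sqrt_continuous.
  by apply: cvgB; [exact: cvg_cst|exact: exprn_continuous].
move/cvgrPdist_lt : sc => /(_ _ e20) sc.
have /cvgrPdist_lt/(_ _ e20) xc : y @[y --> x] --> x by [].
apply: filterS2 xc sc => y; rewrite distrC => xy; rewrite distrC => sy.
have -> : upper_arc y - upper_arc x =
    (y - x)%:C + 'i * (Num.sqrt (1 - y ^+ 2) - Num.sqrt (1 - x ^+ 2))%:C.
  by rewrite /upper_arc; simpc.
rewrite (le_lt_trans (le_normcD _ _))// normcM !normc_real.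
have -> : normc ('i : R[i]) = 1 by rewrite /= expr0n expr1n add0r sqrtr1.
by rewrite mul1r [e]splitr ltrD.
Qed.

Lemma unit_circle_arcs (z : R[i]) : normc z = 1 ->
  exists2 x : R, x \in `[-1, 1] & z = upper_arc x \/ z = - upper_arc x.
Proof.
case: z => x y /= xy1.
have {}xy1 : x ^+ 2 + y ^+ 2 = 1.
  rewrite -[LHS]sqr_sqrtr; first by rewrite xy1 expr1n.
  by rewrite addr_ge0 ?sqr_ge0.
have x_itv : -1 <= x <= 1 by apply/andP; split; nra.
have sy : 1 - x ^+ 2 = y ^+ 2 by rewrite -xy1 addrC addKr.
have [y0|y0] := leP 0 y.
  by exists x; rewrite ?in_itv//; left; rewrite /upper_arc sy sqrtr_sqr ger0_norm.
exists (- x); first by rewrite in_itv /= lerN2 lerNl andbC.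
by right; rewrite /upper_arc sqrrN sy sqrtr_sqr ltr0_norm//; simpc.
Qed.

Lemma unit_circle_upper_arc (x : R) : x \in `[-1, 1] -> normc (upper_arc x) = 1.
Proof.
rewrite in_itv /= => /andP[x1 x2]; rewrite sqr_sqrtr; last by nra.
by rewrite addrC subrK sqrtr1.
Qed.

(** The circle is the union of an upper and a lower arc, both of them images
    of the compact segment [-1, 1] under a continuous map; on a segment a
    locally bounded function is bounded. *)
Lemma locally_bounded_unit_circle (f : R[i] -> R) :
  (forall z, normc z = 1 -> exists2 e, 0 < e &
     exists C, forall w, normc w = 1 -> normc (w - z) < e -> f w <= C) ->
  exists C, forall z, normc z = 1 -> f z <= C.
Proof.
move=> f_loc.
have arc_bounded (g : R[i] -> R) :
    (forall x, x \in `[-1, 1] -> exists2 e, 0 < e &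
      exists C, forall y, y \in `[-1, 1] ->
        normc (upper_arc y - upper_arc x) < e -> g (upper_arc y) <= C) ->
    exists C, forall x, x \in `[-1, 1] -> g (upper_arc x) <= C.
  move=> g_loc.
  have /compact_near_coveringP/near_covering_withinP cover :=
    @segment_compact R (-1) 1.
  (* The covering form of compactness, along the filter of large bounds [C]. *)
  have := cover R +oo (fun C x => g (upper_arc x) <= C) _.
  case=> [x x_itv|M [_ bound]].
    have [e e0 [C gC]] := g_loc x x_itv.
    near=> y C' => /= y_itv.
    apply: le_trans (gC y y_itv _) _.
      near: y; exact: upper_arc_continuous.
    near: C'; apply: nbhs_pinfty_ge; exact: num_real.
  by exists (M + 1) => x x_itv; apply: (bound (M + 1)) => //; rewrite ltrDl.
have [x x_itv|C1 h1] := arc_bounded f.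
  have [e e0 [C fC]] := f_loc _ (unit_circle_upper_arc x_itv).
  exists e => //; exists C => y y_itv; apply: fC.
  exact: unit_circle_upper_arc.
have ncN (z : R[i]) : normc (- z) = normc z by rewrite normcN.
have [x x_itv|C2 h2] := arc_bounded (fun z => f (- z)).
  have nx : normc (- upper_arc x) = 1 by rewrite ncN unit_circle_upper_arc.
  have [e e0 [C fC]] := f_loc _ nx.
  exists e => //; exists C => y y_itv xy; apply: fC.
    by rewrite ncN unit_circle_upper_arc.
  by rewrite -opprD ncN.
exists (Num.max C1 C2) => z /unit_circle_arcs[x x_itv [->|->]].
  by rewrite le_max h1.
by rewrite le_max h2 ?orbT.
Unshelve. all: by end_near. Qed.

End UnitCircle.

(** * The spectral radius of a selfadjoint element *)

Section SpectralRadius.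
Context {R : realType} {A : cstarAlgType R}.
Implicit Types (a b g h : A) (z w : R[i]) (s e : R).

(** Quantifying [z] over the whole unit circle makes the estimate survive
    squaring, since the square roots of a number of modulus 1 have modulus 1. *)
Definition resolvents_close g s e := forall z, normc z = 1 ->
  exists b c, [/\ is_inverse (1 - z *: g) b,
                  is_inverse (1 - (z * s%:C) *: g) c & nrm (b - c) <= e].

(** This is (1 - x^2)^-1 = ((1 - x)^-1 + (1 + x)^-1) / 2 with [x = z *: g];
    the inverse on the left is also the product of the two on the right. *)
Lemma resolvent_square g z b b' :
    is_inverse (1 - z *: g) b -> is_inverse (1 - - z *: g) b' ->
  is_inverse (1 - (z ^+ 2) *: (g * g)) (b' * b) /\
  b' * b = 2^-1 *: (b' + b).
Proof.
move=> ib ib'; have := is_inverseM ib ib'; rewrite scaleNr opprK => ibb'.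
have -> : 1 - z ^+ 2 *: (g * g) = (1 - z *: g) * (1 + z *: g).
  rewrite mulrDr mulr1 mulrBl mul1r -scaleAl -scaleAr.
  rewrite (scalerA z z (g * g)) -expr2.
  by rewrite addrA subrK.
split=> //.
case: ib' => _ b'2.
have -> : b' + b = b' * ((1 - z *: g) + (1 - - z *: g)) * b.
  by rewrite mulrDr mulrDl b'2 mul1r -[b' * _ * b]mulrA (proj1 ib) mulr1.
rewrite scaleNr opprK addrACA addNr addr0 -mulr2n.
rewrite mulr_natr mulrnAl; have <- := scaler_nat (R := R[i]) 2 (b' * b).
rewrite scalerA mulVf ?scale1r//.
by rewrite pnatr_eq0.
Qed.

(** Every [w] of modulus 1 has square roots [z] and [- z] of modulus 1, and
    the average of two differences is no larger than their common bound. *)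
Lemma resolvents_close_square g s e :
  resolvents_close g s e -> resolvents_close (g * g) (s ^+ 2) e.
Proof.
move=> close w w1.
have z1 : normc (sqrtc w) = 1.
  have := normcM (sqrtc w) (sqrtc w); rewrite -expr2 sqr_sqrtc w1 => /esym/eqP.
  rewrite -expr2 sqrf_eq1 => /orP[/eqP//|/eqP zN1].
  by have := normc_ge0 (sqrtc w); rewrite zN1; lra.
have zN1 : normc (- sqrtc w) = 1 by rewrite normcN.
have [b [c [ib ic bc]]] := close _ z1.
have [b' [c' [ib' ic' bc']]] := close _ zN1.
have [ibb bbE] := resolvent_square ib ib'.
rewrite mulNr in ic'.
have [icc ccE] := resolvent_square ic ic'.
rewrite sqr_sqrtc in ibb.
rewrite exprMn sqr_sqrtc -rmorphXn /= in icc.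
exists (b' * b), (c' * c); split => //.
rewrite bbE ccE -scalerBr nrmZ opprD addrACA.
have -> : normc (2^-1 : R[i]) = 2^-1.
  rewrite normcV -[2%:R]/((1 + 1)%:R) -(rmorph_nat (real_complex R)).
  by rewrite normc_real normr_nat.
by have := nrmD (b' - c') (b - c); lra.
Qed.

Lemma resolvents_close_pow h s e n : resolvents_close h s e ->
  resolvents_close (h ^+ (2 ^ n)) (s ^+ (2 ^ n)) e.
Proof.
move=> close; elim: n => [|n IH]; first by rewrite !expn0 !expr1.
by rewrite expnSr !exprM expr2; exact: resolvents_close_square.
Qed.

Lemma selfadjoint_pow h n : selfadjoint h -> selfadjoint (h ^+ n).
Proof.
move=> hh; elim: n => [|n IH]; first by rewrite expr0 /selfadjoint cadj1.
by rewrite /selfadjoint exprS cadjM IH hh -exprSr exprS.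
Qed.

(** The C*-identity, iterated. *)
Lemma nrm_selfadjoint_pow h n :
  selfadjoint h -> nrm (h ^+ (2 ^ n)) = nrm h ^+ (2 ^ n).
Proof.
move=> hh; elim: n => [|n IH]; first by rewrite !expn0 !expr1.
rewrite expnSr !exprM -IH expr2.
by rewrite nrm_selfadjoint_sqr//; exact: selfadjoint_pow.
Qed.

(** After enough squarings [s ^+ 2 ^ n] is at most 1/8, so the inverse [c] of
    [1 - s ^+ 2 ^ n *: g], where [g = h ^+ 2 ^ n], is within 1/7 of 1.  The
    inverse [b] of [1 - g] is then within 1/7 + 1/8 < 1/2 of 1, and
    [g = (b - 1) - g * (b - 1)] contradicts |g| = 1. *)
Lemma not_resolvents_close h s : selfadjoint h -> nrm h = 1 -> 0 <= s < 1 ->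
  ~ resolvents_close h s 8^-1.
Proof.
move=> hh h1 /andP[s0 s1] close.
have [n sn] : exists n, s ^+ (2 ^ n) <= 8^-1.
  have /cvgrPdist_lt/(_ 8^-1) : s ^+ n @[n --> \oo] --> 0.
    by apply: cvg_expr; rewrite ger0_norm.
  case=> [|n _ /(_ n (leqnn n)) /=]; first by rewrite invr_gt0.
  rewrite sub0r normrN ger0_norm ?exprn_ge0// => sn.
  exists n; apply: le_trans (ltW sn); apply: ler_wiXn2l => //; first exact: ltW.
  by rewrite ltnW// ltn_expl.
have g1 : nrm (h ^+ (2 ^ n)) = 1 by rewrite nrm_selfadjoint_pow// h1 expr1n.
have t0 : 0 <= s ^+ (2 ^ n) by rewrite exprn_ge0.
have := resolvents_close_pow n close.
move: (h ^+ (2 ^ n)) (s ^+ (2 ^ n)) g1 t0 sn => g t g1 t0 t8 {}close.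
have [b [c [[gb _] [gc _] bc]]] := close 1 (normc1 R).
rewrite scale1r in gb; rewrite mul1r in gc.
have gbE : b - 1 = g * b by rewrite -gb mulrBl mul1r opprB addrC subrK.
have gcE : c - 1 = t%:C *: (g * c).
  by rewrite scaleAl -gc mulrBl mul1r opprB addrC subrK.
have c1 : nrm (c - 1) <= t * nrm c.
  rewrite gcE nrmZ normc_real ger0_norm// ler_wpM2l//.
  by rewrite (le_trans (nrmM _ _))// g1 mul1r.
have cn : nrm c <= nrm (c - 1) + 1.
  rewrite -{1}[c](subrK 1) (le_trans (nrmD _ _))//.
  by rewrite lerD2l nrm1_le1.
have b1 : nrm (b - 1) <= nrm (b - c) + nrm (c - 1).
  by apply: le_trans (nrmD _ _); rewrite addrA subrK.
have gE : g = (b - 1) - g * (b - 1).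
  by rewrite mulrBr mulr1 gbE opprB addrC subrK.
have : 1 <= nrm (b - 1) + nrm (b - 1).
  rewrite -{1}g1 {1}gE (le_trans (nrmB _ _))// lerD2l.
  by rewrite (le_trans (nrmM _ _))// g1 mul1r.
have := nrm_ge0 c; nra.
Qed.

(** If [M >= 1] bounds the inverses on the circle and [u = 1 - s], then
    [nrm_inverseB_le] bounds the differences by [2 * M ^+ 2 * u]. *)
Lemma resolvents_close_near1 g : nrm g = 1 ->
    (forall z, normc z = 1 -> invertible (1 - z *: g)) ->
  exists2 s, 0 <= s < 1 & resolvents_close g s 8^-1.
Proof.
move=> g1 g_inv.
have [res resP] : exists res : R[i] -> A,
    forall z, normc z = 1 -> is_inverse (1 - z *: g) (res z).
  have /choice[res resP] : forall z, exists b,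
      normc z = 1 -> is_inverse (1 - z *: g) b.
    move=> z; have [/g_inv[b ib]|nz] := pselect (normc z = 1); first by exists b.
    by exists 0.
  by exists res.
have distE z w : nrm ((1 - w *: g) - (1 - z *: g)) = normc (w - z).
  rewrite opprB addrC addrA subrK -scalerBl nrmZ g1 mulr1.
  by rewrite -normcN opprB.
have [C resC] : exists C, forall z, normc z = 1 -> nrm (res z) <= C.
  apply: locally_bounded_unit_circle => z z1.
  have r0 := nrm_ge0 (res z).
  have d0 : 0 < 2 * (nrm (res z) + 1) by lra.
  exists (2 * (nrm (res z) + 1))^-1; first by rewrite invr_gt0.
  exists (2 * nrm (res z)) => w w1 wz.
  apply: nrm_inverse_le (resP _ z1) (resP _ w1) _; rewrite distE.
  have : normc (w - z) * (2 * (nrm (res z) + 1)) < 1.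
    by rewrite -ltr_pdivlMr// div1r.
  by have := normc_ge0 (w - z); nra.
pose M := Num.max 1 C.
have M1 : 1 <= M by rewrite le_max lexx.
have resM z : normc z = 1 -> nrm (res z) <= M.
  by move=> z1; rewrite le_max resC ?orbT.
(* The largest [u] with [2 * M ^+ 2 * u <= 8^-1]. *)
pose u := (16 * M ^+ 2)^-1.
have uM : u * (16 * M ^+ 2) = 1.
  by rewrite mulVf// gt_eqF// mulr_gt0// exprn_gt0//; lra.
have u0 : 0 < u by rewrite invr_gt0 mulr_gt0// exprn_gt0//; lra.
have M2 : 1 <= M ^+ 2 by rewrite exprn_ege1.
have u1 : u <= 16^-1 by have := ler_wpM2l (ltW u0) M2; lra.
exists (1 - u); first by apply/andP; split; lra.
move=> z z1; exists (res z).
have [c ic] : invertible (1 - (z * (1 - u)%:C) *: g).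
  by apply: neumann; rewrite nrmZ g1 mulr1 normcM z1 mul1r normc_real ger0_norm; lra.
exists c; split => //; first exact: resP.
have dist_u : nrm ((1 - (z * (1 - u)%:C) *: g) - (1 - z *: g)) = u.
  rewrite distE -[X in _ - X]mulr1 -mulrBr normcM z1 mul1r.
  rewrite -(rmorph1 (real_complex R)) -rmorphB normc_real /= addrC addKr.
  by rewrite normrN gtr0_norm.
have bM := resM z z1; have b0 := nrm_ge0 (res z).
apply: le_trans (nrm_inverseB_le (resP _ z1) ic _) _; rewrite dist_u; first by nra.
have : nrm (res z) ^+ 2 <= M ^+ 2 by rewrite lerXn2r// nnegrE; lra.
nra.
Qed.

(** Otherwise all resolvents of [h / |h|] on the unit circle exist, which the
    two preceding lemmas exclude. *)
Lemma selfadjoint_spectral_radius h : selfadjoint h -> h != 0 ->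
  exists2 z, spectrum h z & normc z = nrm h.
Proof.
move=> hh h0; apply: contrapT => no_z.
have nh0 : 0 < nrm h.
  rewrite lt_def nrm_ge0 andbT; apply: contra_neq h0; exact: nrm_eq0.
have nhC : (nrm h)%:C != 0 by rewrite (inj_eq (@complexI R)) gt_eqF.
pose g := (nrm h)^-1%:C *: h.
have g1 : nrm g = 1.
  by rewrite nrmZ normc_real gtr0_norm ?invr_gt0// mulVf// gt_eqF.
have gg : selfadjoint g by rewrite /selfadjoint cadj_real_scale hh.
have [z z1|s s01 close] := resolvents_close_near1 g1.
  have z0 : z != 0.
    by apply: contra_eq_neq z1 => ->; rewrite normc0 eq_sym oner_neq0.
  have -> : 1 - z *: g =
      (z / (nrm h)%:C) *: (((nrm h)%:C / z) *: (1 : A) - h).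
    by rewrite scalerBr !scalerA mulrA divfK// mulfV// scale1r fmorphV.
  apply: invertibleZ; first by rewrite mulf_neq0 ?invr_eq0.
  apply: contrapT => zh; apply: no_z; exists ((nrm h)%:C / z) => //.
  by rewrite normcM normcV z1 invr1 mulr1 normc_real gtr0_norm.
exact: not_resolvents_close gg g1 s01 close.
Qed.

End SpectralRadius.

(** * Monotonicity of the norm on positive elements *)

Section PositiveElements.
Context {R : realType} {A : cstarAlgType R}.
Implicit Types (p q h : A) (t : R).

Lemma selfadjointB p q : selfadjoint p -> selfadjoint q -> selfadjoint (p - q).
Proof. by move=> pp qq; rewrite /selfadjoint cadjB pp qq. Qed.

Lemma selfadjoint_scalar t : selfadjoint (t%:C *: (1 : A)).
Proof. by rewrite /selfadjoint cadj_real_scale cadj1. Qed.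

(** The spectrum of [t - q] lies in [0, t], because that of [q] lies in
    [0, |q|]; the norm of [t - q] is the modulus of one of its spectral values. *)
Lemma positive_nrm_scalar_sub q t :
  cpositive q -> nrm q <= t -> nrm (t%:C *: (1 : A) - q) <= t.
Proof.
move=> [qq q_spec] qt; have t0 := le_trans (nrm_ge0 q) qt.
have [->|h0] := eqVneq (t%:C *: (1 : A) - q) 0; first by rewrite nrm0.
have hh := selfadjointB (selfadjoint_scalar t) qq.
have [z zh <-] := selfadjoint_spectral_radius hh h0.
have tz : spectrum q (t%:C - z).
  move=> inv; apply: zh; apply: invertibleN.
  by rewrite opprB addrAC -scalerBl.
have [x x0 tzx] := ge0_complexP (q_spec _ tz).
have := spectrum_le_nrm tz; rewrite tzx normc_real ger0_norm// => xq.
have -> : z = (t - x)%:C by rewrite rmorphB /= -tzx opprB addrC subrK.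
by rewrite normc_real ger0_norm; lra.
Qed.

(** Positivity makes the spectral value of modulus |p| equal to |p| itself, so
    |p| + t is a spectral value of [t + p]. *)
Lemma positive_nrm_scalar_add p t :
  cpositive p -> p != 0 -> 0 <= t -> nrm p + t <= nrm (t%:C *: (1 : A) + p).
Proof.
move=> [pp p_spec] p0 t0.
have [z zp] := selfadjoint_spectral_radius pp p0.
have [x x0 zx] := ge0_complexP (p_spec _ zp).
rewrite zx normc_real ger0_norm// => <-.
rewrite -[leLHS]ger0_norm; last by lra.
rewrite -normc_real; apply: spectrum_le_nrm => inv; apply: zp.
by move: inv; rewrite rmorphD /= scalerDl opprD addrA addrK zx.
Qed.

(** Subtracting [q1] from |q1| and [q2] from |q2| costs no norm, while adding
    |q1| + |q2| to [p] raises the norm by the full amount; the triangle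
    inequality compares the two.  A chain of two inequalities starting at [p]
    enters through its differences [q1] and [q2]. *)
Lemma nrm_le_positive_add2 p q1 q2 :
  cpositive p -> cpositive q1 -> cpositive q2 -> nrm p <= nrm (p + q1 + q2).
Proof.
move=> p_pos q1_pos q2_pos.
have [->|p0] := eqVneq p 0; first by rewrite nrm0 nrm_ge0.
have h1 := positive_nrm_scalar_sub q1_pos (lexx _).
have h2 := positive_nrm_scalar_sub q2_pos (lexx _).
have t0 : 0 <= nrm q1 + nrm q2 by rewrite addr_ge0 ?nrm_ge0.
have := positive_nrm_scalar_add p_pos p0 t0.
have -> : (nrm q1 + nrm q2)%:C *: (1 : A) + p =
    ((nrm q1)%:C *: (1 : A) - q1) + ((nrm q2)%:C *: (1 : A) - q2) + (p + q1 + q2).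
  by rewrite [X in X + (p + _ + _)]addrACA -opprD -[p + _ + _]addrA
    [p + (_ + _)]addrC addrA (subrK (q1 + q2)) rmorphD /= scalerDl.
have := nrmD ((nrm q1)%:C *: (1 : A) - q1 + ((nrm q2)%:C *: (1 : A) - q2)) (p + q1 + q2).
have := nrmD ((nrm q1)%:C *: (1 : A) - q1) ((nrm q2)%:C *: (1 : A) - q2); lra.
Qed.

End PositiveElements.

Theorem theorem7 (R : realType) (A : cstarAlgType R) (X : Type)
    (d : X -> X -> A) (d_metric : is_cstar_metric d)
    (x0 : X) (r : A) (r_ge0 : cpositive r)
    (phi : X -> A) (phiE : forall x, phi x = d x x0)
    (T : X -> X)
    (T_caristi : exists a : A, `|a| < 1 /\
       forall x, circle d x0 r x ->
         cle (d x (T x)) (phi x - phi (T x)) /\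
         cle r (adj a * d x (T x) * a + d (T x) x0)) :
  fixed_circle T (circle d x0 r).
Proof.
have [a [a_lt1 T_cond]] := T_caristi.
move=> x xC; have [[_ _ le1] [_ _ le2]] := T_cond x xC.
apply/esym/(cmetric_eq0 d_metric).
move: le1 le2; rewrite !phiE (xC : d x x0 = r).
have := cmetric_ge0 d_metric x (T x).
move: (d x (T x)) (d (T x) x0) => p u p_pos le1 le2.
have := nrm_le_positive_add2 p_pos le1 le2.
have -> : p + (r - u - p) + (adj a * p * a + u - r) = adj a * p * a.
  by rewrite [p + _]addrC subrK -[_ + u - r]addrA -[u - r]opprB
    [_ - (r - u)]addrC addrA subrr add0r.
have {}a_lt1 : nrm a < 1 by rewrite -ltcR -nrmE.
move=> p_le; apply: nrm_eq0; apply/eqP; rewrite eq_le nrm_ge0 andbT.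
have := le_trans p_le (nrmM _ _).
have := ler_wpM2r (nrm_ge0 a) (nrmM (adj a) p); rewrite nrm_adj.
have := nrm_ge0 a; have := nrm_ge0 p => p0 a0 le_apa le_p.
have : nrm a * nrm p * nrm a <= nrm p * nrm a.
  by rewrite ler_wpM2r// ler_piMl// ltW.
have : nrm p * nrm a <= nrm p by rewrite ler_piMr// ltW.
nra.
Qed.
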